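(* Let $n\ge 3$ be an odd integer, let $K$ be the $(2,n)$-torus knot with the standard diagram $D$ described in the context, let $r>0$, $G=SL(2,\mathbb{R})$, let $\rho\in\operatorname{Inn}G$ be an inner automorphism, and let $x=\rho(D(r))$ where $D(r)=\begin{pmatrix}e^r&0\\0&e^{-r}\end{pmatrix}$. Then $$\mathcal{L}^x_G(\Psi_{K,r}(\rho\circ C_0))=\begin{pmatrix}1&0\\0&1\end{pmatrix},$$ and for every $j\in\{1,3,\dots,n-2\}$ and all $b,c\in\mathbb{R}$ with $bc=-\frac{4\sin^2\theta_j(\sin^2\theta_j+\sinh^2 r)}{\sinh^2 r}$, where $\theta_j=\frac{\pi j}{2n}$, $$\mathcal{L}^x_G(\Psi_{K,r}(\rho\circ C_{j,b,c}))=\rho\left(\begin{pmatrix}-e^{-2nr}&0\\0&-e^{2nr}\end{pmatrix}\right).$$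
   Context: Diagram: $D$ is the standard oriented diagram of the $(2,n)$-torus knot (closure of a 2-braid with $n$ crossings), with arcs $\alpha_0,\dots,\alpha_{n-1}$ (indices mod $n$); for each $i$ there is one crossing with over-arc $\alpha_{i+1}$, incoming under-arc $\alpha_i$ and outgoing under-arc $\alpha_{i+2}$. The knot group $\pi_1(S^3\setminus K)$ has the Wirtinger presentation with generators $\alpha_0,\dots,\alpha_{n-1}$ and relations $\alpha_{i+2}=\alpha_{i+1}^{-1}\alpha_i\alpha_{i+1}$. The meridian is $\mathfrak{m}=\alpha_0$, and $\mathfrak{l}$ is the corresponding preferred longitude: travel once along the knot starting on $\alpha_0$, multiply from left to right the generators of the over-arcs met at the under-crossings (each with exponent $+1$), and then multiply on the right by the power of $\alpha_0$ making the total exponent sum zero. Colorings: $S^2_1(r)=\{g^{-1}D(r)g: g\in SL(2,\mathbb{R})\}$ is a quandle under $x\triangleright y=y^{-1}xy$. An $S^2_1(r)$-coloring of $D$ is a map $C:\{\alpha_0,\dots,\alpha_{n-1}\}\to S^2_1(r)$ with $C(\alpha_{i+2})=C(\alpha_{i+1})^{-1}C(\alpha_i)C(\alpha_{i+1})$ for all $i$ (indices mod $n$). A coloring is determined by its values on $\alpha_0,\alpha_1$. $C_0$ is the constant coloring with value $D(r)$. For $j\in\{1,3,\dots,n-2\}$ and $b,c\in\mathbb{R}$ with $bc=-\frac{4\sin^2\theta_j(\sin^2\theta_j+\sinh^2 r)}{\sinh^2 r}$, $\theta_j=\frac{\pi j}{2n}$, $C_{j,b,c}$ is the coloring with $C_{j,b,c}(\alpha_0)=D(r)$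 and $C_{j,b,c}(\alpha_1)=\begin{pmatrix}a&b\\c&d\end{pmatrix}$, where $a=\frac{-e^{-r}\cosh r+\cos 2\theta_j}{\sinh r}$ and $d=\frac{e^r\cosh r-\cos 2\theta_j}{\sinh r}$. For a coloring $C$, $\Psi_{K,r}(C):\pi_1(S^3\setminus K)\to SL(2,\mathbb{R})$ is the homomorphism with $\alpha_i\mapsto C(\alpha_i)$ for all $i$. Longitudinal mapping: for a group $G$ and $x\in G$, $\mathcal{L}^x_G=\mathcal{L}^x_G(K):\{f\in\operatorname{Hom}(\pi_1(S^3\setminus K),G): f(\mathfrak{m})=x\}\to G$ is $f\mapsto f(\mathfrak{l})$. *)

(* Defs.v *)
From HB Require Import structures.
From mathcomp Require Import all_boot all_order all_algebra generic_quotient.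
From mathcomp Require Import ring lra.
From mathcomp Require Import boolp classical_sets reals sequences exp trigo.
Set Implicit Arguments.
Unset Strict Implicit.
Unset Printing Implicit Defensive.
Import Order.TTheory GRing.Theory Num.Theory.
Local Open Scope ring_scope.

Record inner_automorphism (G : groupType) := InnerAutomorphism {
  inner_fun :> G -> G;
  innerP : exists g : G, forall y : G, inner_fun y = (g^-1 * y * g)%g }.

(* A letter (x, false) stands for the generator x, and (x, true) for x^-1. *)
Notation word X := (seq (X * bool)).

Definition word_inv (X : Type) (u : word X) : word X :=
  rev [seq (l.1, ~~ l.2) | l <- u].

Inductive word_cong (X : Type) (R : word X -> word X -> Prop) :
  word X -> word X -> Prop :=
| cong_refl u : word_cong R u u
| cong_sym u v : word_cong R u v -> word_cong R v u
| cong_trans u v w : word_cong R u v -> word_cong R v w -> word_cong R u w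
| cong_cat u u' v v' : word_cong R u u' -> word_cong R v v' ->
    word_cong R (u ++ v) (u' ++ v')
| cong_cancel x b : word_cong R [:: (x, b); (x, ~~ b)] [::]
| cong_rel u v : R u v -> word_cong R u v.

Section Presented.
Variables (X : choiceType) (R : word X -> word X -> Prop).

Definition word_congb : rel (word X) := fun u v => `[< word_cong R u v >].

Lemma word_congb_refl : reflexive word_congb.
Proof. by move=> u; apply/asboolP; exact: cong_refl. Qed.

Lemma word_congb_sym : symmetric word_congb.
Proof. by move=> u v; apply/asboolP/asboolP; exact: cong_sym. Qed.

Lemma word_congb_trans : transitive word_congb.
Proof.
move=> v u w /asboolP uv /asboolP vw; apply/asboolP.
exact: cong_trans uv vw.
Qed.

Canonical word_congb_equiv :=
  EquivRel word_congb word_congb_refl word_congb_sym word_congb_trans.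

Definition presented_group : Type := {eq_quot word_congb}%qT.

HB.instance Definition _ := Choice.on presented_group.
HB.instance Definition _ := EqQuotient.on presented_group.

Let cls (u : word X) : presented_group := \pi_presented_group%qT u.

Lemma presented_eqP (u v : word X) : cls u = cls v <-> word_cong R u v.
Proof.
split=> [/eqP|h]; last by apply/eqP; rewrite /cls eqquotE; apply/asboolP.
by rewrite /cls eqquotE => /asboolP.
Qed.

Let cls_repr (x : presented_group) : cls (repr x) = x.
Proof. by rewrite /cls reprK. Qed.

Definition presented_one : presented_group := cls [::].
Definition presented_mul (x y : presented_group) : presented_group :=
  cls (repr x ++ repr y).
Definition presented_inv (x : presented_group) : presented_group :=
  cls (word_inv (repr x)).

Lemma presented_mulE u v : presented_mul (cls u) (cls v) = cls (u ++ v).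
Proof.
by apply/presented_eqP; apply: cong_cat; apply/presented_eqP; exact: cls_repr.
Qed.

Lemma word_cong_inv u v :
  word_cong R u v -> word_cong R (word_inv u ++ v) [::].
Proof.
move=> uv; apply: (@cong_trans _ _ _ (word_inv u ++ u)).
  by apply: cong_cat; [exact: cong_refl | exact: cong_sym].
elim: u {uv v} => [|[x b] u ih]; first exact: cong_refl.
rewrite /word_inv /= rev_cons -/(word_inv u) cat_rcons /=.
apply: cong_trans ih; apply: cong_cat; first exact: cong_refl.
rewrite -[X in word_cong _ _ X]cat0s.
rewrite -[X in word_cong _ X _]/([:: (x, ~~ b); (x, b)] ++ u).
apply: cong_cat; last exact: cong_refl.
by rewrite -{2}[b]negbK; exact: cong_cancel.
Qed.

Lemma presented_mulA : associative presented_mul.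
Proof.
move=> x y z; rewrite -[x]cls_repr -[y]cls_repr -[z]cls_repr.
by rewrite !presented_mulE catA.
Qed.

Lemma presented_mul1 : left_id presented_one presented_mul.
Proof. by move=> x; rewrite -[x]cls_repr presented_mulE. Qed.

Lemma presented_mulr1 : right_id presented_one presented_mul.
Proof. by move=> x; rewrite -[x]cls_repr presented_mulE cats0. Qed.

Lemma presented_mulV :
  left_inverse presented_one presented_inv presented_mul.
Proof.
move=> x; rewrite -[in X in presented_mul _ X](cls_repr x) presented_mulE.
by apply/presented_eqP/word_cong_inv/cong_refl.
Qed.

Lemma presented_mulrV :
  right_inverse presented_one presented_inv presented_mul.
Proof.
move=> x; rewrite -[LHS]presented_mul1.
rewrite -{1}(presented_mulV (presented_inv x)) -presented_mulA.
rewrite [X in presented_mul _ X]presented_mulA presented_mulV presented_mul1.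
exact: presented_mulV.
Qed.

HB.instance Definition _ := isGroup.Build presented_group
  presented_mulA presented_mul1 presented_mulr1 presented_mulV presented_mulrV.

Definition generator (x : X) : presented_group := cls [:: (x, false)].

Section UniversalProperty.
Variables (G : groupType) (c : X -> G).

Definition word_eval (u : word X) : G :=
  (\prod_(l <- u) (if l.2 then (c l.1)^-1 else c l.1))%g.

Definition respects_relations : Prop :=
  forall u v, R u v -> word_eval u = word_eval v.

Hypothesis c_rel : respects_relations.

Lemma word_eval_cong u v : word_cong R u v -> word_eval u = word_eval v.
Proof.
elim=> {u v} // [u v w _ -> _ -> //|u u' v v' _ hu _ hv|x b].
  by rewrite /word_eval !big_cat /= -/(word_eval u) -/(word_eval v) hu hv.
rewrite /word_eval !big_cons !big_nil mulg1 /=.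
by case: b => /=; rewrite ?mulVg ?mulgV.
Qed.

Definition presented_lift (_ : respects_relations) (x : presented_group) : G :=
  word_eval (repr x).

Lemma presented_lift_cls u : presented_lift c_rel (cls u) = word_eval u.
Proof. by apply: word_eval_cong; apply/presented_eqP; exact: cls_repr. Qed.

Lemma presented_lift_mul :
  {morph presented_lift c_rel : x y / (x * y)%g}.
Proof.
move=> x y; rewrite -[x]cls_repr -[y]cls_repr.
rewrite -[(cls _ * cls _)%g]/(presented_mul _ _) presented_mulE.
by rewrite !presented_lift_cls /word_eval big_cat.
Qed.

HB.instance Definition _ :=
  isMultiplicative.Build presented_group G (presented_lift c_rel)
    presented_lift_mul.

Lemma presented_lift_generator x : presented_lift c_rel (generator x) = c x.
Proof. by rewrite presented_lift_cls /word_eval big_seq1. Qed.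

End UniversalProperty.
End Presented.

Section SL.
Variables (n : nat) (R : comUnitRingType).

Record SL : Type := MkSL { SLval :> 'M[R]_n; SL_det1 : \det SLval == 1 }.

HB.instance Definition _ := [isSub for SLval].
HB.instance Definition _ := [Choice of SL by <:].

Lemma SL_detE (A : SL) : \det A = 1. Proof. exact/eqP/SL_det1. Qed.

Lemma SL_unit (A : SL) : (A : 'M_n) \in unitmx.
Proof. by rewrite unitmxE SL_detE unitr1. Qed.

Fact SL_one_det : \det (1%:M : 'M[R]_n) == 1.
Proof. by rewrite det1. Qed.
Fact SL_mul_det (A B : SL) : \det (A *m B) == 1.
Proof. by rewrite det_mulmx !SL_detE mulr1. Qed.
Fact SL_inv_det (A : SL) : \det (invmx A) == 1.
Proof. by rewrite det_inv SL_detE invr1. Qed.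

Definition SL_one := MkSL SL_one_det.
Definition SL_mul A B := MkSL (SL_mul_det A B).
Definition SL_inv A := MkSL (SL_inv_det A).

Fact SL_mulA : associative SL_mul.
Proof. by move=> A B C; apply: val_inj; rewrite /= mulmxA. Qed.
Fact SL_mul1 : left_id SL_one SL_mul.
Proof. by move=> A; apply: val_inj; rewrite /= mul1mx. Qed.
Fact SL_mulr1 : right_id SL_one SL_mul.
Proof. by move=> A; apply: val_inj; rewrite /= mulmx1. Qed.
Fact SL_mulV : left_inverse SL_one SL_inv SL_mul.
Proof. by move=> A; apply: val_inj; rewrite /= mulVmx ?SL_unit. Qed.
Fact SL_mulrV : right_inverse SL_one SL_inv SL_mul.
Proof. by move=> A; apply: val_inj; rewrite /= mulmxV ?SL_unit. Qed.

HB.instance Definition _ :=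
  isGroup.Build SL SL_mulA SL_mul1 SL_mulr1 SL_mulV SL_mulrV.
End SL.

Definition mx2 (R : nzRingType) (a b c d : R) : 'M[R]_2 :=
  \matrix_(i, j) (if i == 0 then if j == 0 then a else b
                  else if j == 0 then c else d).

Section Matrix2.
Variable R : comUnitRingType.
Implicit Types a b c d : R.

Lemma det_mx2 a b c d : \det (mx2 a b c d) = a * d - b * c.
Proof.
rewrite (expand_det_row _ 0) !big_ord_recl big_ord0 /cofactor !det_mx11.
by rewrite !mxE /=; ring.
Qed.

Lemma mulmx2 a b c d a' b' c' d' : mx2 a b c d *m mx2 a' b' c' d' =
  mx2 (a * a' + b * c') (a * b' + b * d') (c * a' + d * c') (c * b' + d * d').
Proof.
apply/matrixP => i j; rewrite !mxE !big_ord_recl big_ord0 !mxE /= addr0.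
by case: (i == 0); case: (j == 0).
Qed.

Fact SL2_det a b c d : a * d - b * c = 1 -> \det (mx2 a b c d) == 1.
Proof. by rewrite det_mx2 => ->. Qed.

Definition SL2 a b c d (h : a * d - b * c = 1) : SL 2 R := MkSL (SL2_det h).

Lemma mx2E (A : 'M[R]_2) : A = mx2 (A 0 0) (A 0 1) (A 1 0) (A 1 1).
Proof.
apply/matrixP => i j; rewrite !mxE.
by case: (unliftP 0 i) => [k|] ->; case: (unliftP 0 j) => [l|] -> //=;
   rewrite ?[k]ord1 ?[l]ord1; congr (A _ _); apply: val_inj.
Qed.

Lemma tr_mx2 a b c d : \tr (mx2 a b c d) = a + d.
Proof. by rewrite /mxtrace !big_ord_recl big_ord0 !mxE /= addr0. Qed.

Lemma scalar_mx2 a : a%:M = mx2 a 0 0 a :> 'M[R]_2.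
Proof. by rewrite [LHS]mx2E !mxE. Qed.

Lemma SL2_sqr (A : SL 2 R) : A *m A = \tr A *: (A : 'M_2) - 1%:M.
Proof.
have := SL_detE A; rewrite [A : 'M_2]mx2E det_mx2 tr_mx2 mulmx2 scalar_mx2.
set a := A 0 0; set b := A 0 1; set c := A 1 0; set d := A 1 1 => dE.
apply/matrixP => i j; rewrite !mxE.
by case: (i == 0); case: (j == 0) => //; [|ring|ring|]; rewrite -dE; ring.
Qed.

Lemma SL2_tr_inv (A : SL 2 R) : \tr (A^-1)%g = \tr A.
Proof.
have : invmx A *m (A *m A) = invmx A *m (\tr A *: (A : 'M_2) - 1%:M).
  by rewrite SL2_sqr.
rewrite mulKmx ?SL_unit // mulmxBr mulmx1 -scalemxAr mulVmx ?SL_unit //.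
move/(congr1 mxtrace); rewrite raddfB /= mxtraceZ mxtrace1 => trE.
rewrite -[LHS]/(\tr (invmx A)).
by rewrite (_ : \tr (invmx A) = \tr A * 2%:R - \tr A); [ring | rewrite {2}trE; ring].
Qed.
End Matrix2.
Arguments SL2 {R} a b c d h.

(* The arcs are indexed by 'Z_n, which is Z/nZ as soon as 1 < n, and a crossing
   is named after its incoming under-arc i. *)
Definition over_arc (n : nat) (i : 'Z_n) : 'Z_n := (i + 1)%R.
Definition out_arc (n : nat) (i : 'Z_n) : 'Z_n := (i + 2%:R)%R.

Definition wirtinger (n : nat) (u v : word 'Z_n) : Prop :=
  exists i : 'Z_n, u = [:: (out_arc i, false)] /\
    v = [:: (over_arc i, true); (i, false); (over_arc i, false)].

Definition knot_group (n : nat) : groupType := presented_group (@wirtinger n).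

Definition alpha (n : nat) (i : 'Z_n) : knot_group n :=
  generator (@wirtinger n) i.

Definition meridian (n : nat) : knot_group n := alpha 0%R.

(* The k-th under-crossing met from alpha_0 on is the one at which the arc
   iter k out_arc 0 ends; all n crossings are positive. *)
Definition longitude (n : nat) : knot_group n :=
  ((\prod_(k < n) alpha (over_arc (iter k (@out_arc n) 0%R)))
     * (alpha 0%R)^- n)%g.

Definition homs_at (n : nat) (G : groupType) (x : G) : Type :=
  {f : {multiplicative knot_group n -> G} | f (meridian n) = x}.

Definition longitudinal_map (n : nat) (G : groupType) (x : G)
  (f : homs_at n x) : G := sval f (longitude n).

(* The sequence x_0 = x, x_1 = y, x_(k+2) = x_(k+1)^-1 x_k x_(k+1). *)
Section BraidSequence.
Variable G : groupType.
Implicit Types x y : G.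

Fixpoint braid_seq x y (k : nat) : G :=
  if k is k'.+1 then braid_seq y (y^-1 * x * y)%g k' else x.

Lemma braid_seqSS x y k : braid_seq x y k.+2 =
  ((braid_seq x y k.+1)^-1 * braid_seq x y k * braid_seq x y k.+1)%g.
Proof. by elim: k x y => [|k ih] x y //; exact: ih. Qed.

Lemma braid_seqD x y n k : braid_seq x y (n + k) =
  braid_seq (braid_seq x y n) (braid_seq x y n.+1) k.
Proof. by elim: n x y => [|n ih] x y //=; exact: ih. Qed.

Lemma braid_seqE x y k :
  braid_seq x y k.*2 = (x ^ (x * y) ^+ k)%g /\
  braid_seq x y k.*2.+1 = (y ^ (x * y) ^+ k)%g.
Proof.
elim: k => [|k [ih0 ih1]]; first by rewrite !expg0 !conjg1.
rewrite doubleS.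
have h0 : braid_seq x y k.*2.+2 = (x ^ (x * y) ^+ k.+1)%g.
  rewrite braid_seqSS ih0 ih1 -mulgA -conjgE -conjJg expgS conjgM.
  by congr (_ ^ _)%g; rewrite !conjgE invgM -!mulgA mulKg.
split=> //; rewrite braid_seqSS h0 ih1 -mulgA -conjgE.
rewrite expgS !(conjgM _ (x * y)) -conjJg.
congr (_ ^ _)%g; rewrite !conjgE !invgM -?mulgA.
by rewrite !invgK mulKg mulVKg mulKg.
Qed.

Section Periodic.
Variables (x y : G) (n : nat).
Hypotheses (per0 : braid_seq x y n = x) (per1 : braid_seq x y n.+1 = y).

Lemma braid_seq_mod k : braid_seq x y (k %% n) = braid_seq x y k.
Proof.
rewrite [in RHS](divn_eq k n); elim: (k %/ n)%N => [|q ih] //.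
by rewrite mulSn -addnA braid_seqD per0 per1.
Qed.

Lemma braid_seq_crossing (i : 'Z_n) : (1 < n)%N ->
  braid_seq x y (out_arc i) =
  ((braid_seq x y (over_arc i))^-1 * braid_seq x y i
     * braid_seq x y (over_arc i))%g.
Proof.
move=> n1; have nE := Zp_cast n1.
have e1 : over_arc i = ((i + 1) %% n)%N :> nat.
  by rewrite /= modnDmr; congr modn.
have e2 : out_arc i = ((i + 2) %% n)%N :> nat.
  by rewrite /= modnDmr addnA modnDmr addnAC modnDmr -addnA; congr modn.
by rewrite e1 e2 !braid_seq_mod addn1 addn2 braid_seqSS.
Qed.
End Periodic.
End BraidSequence.

Section Colorings.
Variable R : realType.

Definition sinh (r : R) : R := (expR r - expR (- r)) / 2.
Definition cosh (r : R) : R := (expR r + expR (- r)) / 2.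

Fact Dmx_det (r : R) : expR r * expR (- r) - 0 * 0 = 1.
Proof. by rewrite expRxMexpNx_1 mulr0 subr0. Qed.
Definition Dmx (r : R) : SL 2 R := SL2 (expR r) 0 0 (expR (- r)) (Dmx_det r).

Definition S21 (r : R) : set (SL 2 R) :=
  [set x | exists g : SL 2 R, x = (g^-1 * Dmx r * g)%g].

Record coloring (n : nat) (r : R) := Coloring {
  color :> 'Z_n -> SL 2 R;
  color_S21 : forall i, S21 r (color i);
  color_crossing : forall i,
    color (out_arc i) = ((color (over_arc i))^-1 * color i * color (over_arc i))%g }.

Section Psi.
Variables (n : nat) (r : R) (C : coloring n r).

Fact color_respects : respects_relations (@wirtinger n) C.
Proof.
move=> u v [i [-> ->]]; rewrite /word_eval !big_cons !big_nil /= !mulg1.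
by rewrite color_crossing mulgA.
Qed.

Definition Psi : {multiplicative knot_group n -> SL 2 R} :=
  presented_lift color_respects.

Lemma Psi_alpha i : Psi (alpha i) = C i.
Proof. exact: presented_lift_generator. Qed.
End Psi.

Section Inner.
Variables (n : nat) (r : R) (rho : inner_automorphism (SL 2 R)).
Variable (C : coloring n r).

Fact inner_color_S21 i : S21 r (rho (C i)).
Proof.
have [g rhoE] := innerP rho; have [h ->] := color_S21 C i.
by exists (h * g)%g; rewrite rhoE invgM !mulgA.
Qed.

Fact inner_color_crossing i : rho (C (out_arc i)) =
  ((rho (C (over_arc i)))^-1 * rho (C i) * rho (C (over_arc i)))%g.
Proof.
have [g rhoE] := innerP rho; rewrite color_crossing !rhoE.
by rewrite !invgM invgK !mulgA !mulgK.
Qed.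

Definition inner_coloring : coloring n r :=
  Coloring inner_color_S21 inner_color_crossing.

Lemma Psi_inner_meridian : C 0 = Dmx r ->
  Psi inner_coloring (meridian n) = rho (Dmx r).
Proof. by rewrite Psi_alpha /= => ->. Qed.
End Inner.

Section ConstantColoring.
Variables (n : nat) (r : R).

Fact C0_S21 (i : 'Z_n) : S21 r (Dmx r).
Proof. by exists 1%g; rewrite invg1 mul1g mulg1. Qed.
Fact C0_crossing (i : 'Z_n) : Dmx r = ((Dmx r)^-1 * Dmx r * Dmx r)%g.
Proof. by rewrite mulVg mul1g. Qed.

Definition C0 : coloring n r := Coloring C0_S21 C0_crossing.

Lemma C0_alpha0 : C0 0 = Dmx r. Proof. by []. Qed.
End ConstantColoring.

Definition theta (n j : nat) : R := pi * j%:R / (2 * n%:R).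

Section Closing.
Implicit Types A x y : SL 2 R.

Lemma SL2_expg A (t : R) k : \tr A = 2 * cos t ->
  sin t *: SLval (A ^+ k.+1)%g =
    sin (t *+ k.+1) *: (A : 'M_2) - sin (t *+ k) *: 1%:M :> 'M[R]_2.
Proof.
move=> trA; elim: k => [|k ih].
  by rewrite expg1 mulr1n mulr0n sin0 scale0r subr0.
rewrite expgS -[SLval _]/(SLval A *m SLval (A ^+ k.+1)%g).
rewrite scalemxAr ih mulmxBr -!scalemxAr SL2_sqr trA mulmx1.
rewrite scalerBr scalerA addrAC -scalerBl; congr (_ *: _ - _).
rewrite [t *+ k.+2]mulrSr sinD.
have -> : t *+ k = t *+ k.+1 - t by rewrite mulrSr addrK.
by rewrite sinB; ring.
Qed.

Lemma braid_closing x y (t : R) m :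
  \tr x = \tr y -> \tr (x * y)%g = 2 * cos t -> sin t != 0 ->
  sin (t *+ m.*2.+1) = 0 -> cos (t *+ m.*2.+1) = -1 ->
  (y ^ (x * y) ^+ m = x)%g /\ (x ^ (x * y) ^+ m.+1 = y)%g.
Proof.
move=> trxy trD st0 sn cn; set D := (x * y)%g in trD *.
pose z : SL 2 R := (D ^+ m.*2.+1)%g.
have zE : (z : 'M_2) = - 1%:M.
  apply: (scalerI st0); rewrite SL2_expg // sn scale0r add0r scalerN.
  congr (- (_ *: _)).
  have -> : t *+ m.*2 = t *+ m.*2.+1 - t by rewrite mulrSr addrK.
  by rewrite sinB sn cn; ring.
pose V : SL 2 R := (D ^+ m * x)%g.
have VE : V = (D ^+ m.+1 * y^-1)%g by rewrite expgSr /D -!mulgA mulgV mulg1.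
have trV : \tr V = 0.
  apply: (mulfI st0); rewrite mulr0 -mxtraceZ VE.
  rewrite -[SLval _]/(SLval (D ^+ m.+1)%g *m SLval (y^-1)%g).
  rewrite scalemxAl SL2_expg // mulmxBl -!scalemxAl mul1mx raddfB /= !mxtraceZ.
  rewrite -[_ *m _]/(SLval (D * y^-1)%g) SL2_tr_inv.
  rewrite /D mulgK -trxy -mulrBl.
  have -> : t *+ m.+1 = t *+ m.*2.+1 - t *+ m.
    by rewrite -mulrnBr -addnn ?subSn ?addnK // -?addnS ?leq_addr.
  by rewrite sinB sn cn; ring.
have VV : (V * V)%g = z.
  by apply: val_inj; rewrite -[LHS]/(SLval V *m SLval V) SL2_sqr trV scale0r sub0r -zE.
have e0 : (y ^ D ^+ m)%g = x.
  rewrite conjgE; apply: (mulgI (V * D ^+ m)%g); apply/esym.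
  rewrite /V mulgA.
  have -> : (D ^+ m * x * D ^+ m * x)%g = z by rewrite -VV /V !mulgA.
  rewrite !mulgA mulgK -!mulgA (mulgA x y) -/D -expgS -expgnDr.
  by rewrite /z -addnn addnS.
split=> //; rewrite -[x in (x ^ _)%g]e0 -conjgM -expgnDr addnS addnn -/z.
rewrite conjgE; apply: (mulgI z); rewrite mulVKg; apply: val_inj.
by rewrite /= zE mulmxN mulNmx mulmx1 mul1mx.
Qed.
End Closing.

Lemma trig_pi_odd j : odd j ->
  sin (pi * j%:R : R) = 0 /\ cos (pi * j%:R : R) = -1.
Proof.
move=> oj; have -> : j = j./2.*2.+1 by rewrite -[LHS]odd_double_half oj.
elim: (j./2) => [|k [ihs ihc]]; first by rewrite mulr1 sinpi cospi.
have -> : pi * (k.+1.*2.+1)%:R = pi * (k.*2.+1)%:R + pi *+ 2 :> R.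
  by rewrite doubleS -[k.*2.+3]addn2 natrD mulrDr (mulr_natr pi 2).
by rewrite sinD2pi cosD2pi.
Qed.

Section TorusColoring.
Variables (n j : nat) (r b c : R).

Definition torus_a : R := (- expR (- r) * cosh r + cos (2 * theta n j)) / sinh r.
Definition torus_d : R := (expR r * cosh r - cos (2 * theta n j)) / sinh r.

Hypotheses (n3 : (3 <= n)%N) (n_odd : odd n) (r0 : 0 < r).
Hypotheses (j_odd : odd j) (j_le : (j <= n - 2)%N).
Hypothesis bcE : b * c =
  - (4 * sin (theta n j) ^+ 2 * (sin (theta n j) ^+ 2 + sinh r ^+ 2))
    / sinh r ^+ 2.

Lemma sinh_gt0 : 0 < sinh r.
Proof. by rewrite divr_gt0 // subr_gt0 ltr_expR gtrN. Qed.

Fact torus_det : torus_a * torus_d - b * c = 1.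
Proof.
have s0 : sinh r != 0 by rewrite gt_eqF ?sinh_gt0.
have e1 : expR r * expR (- r) = 1 by exact: expRxMexpNx_1.
pose k : R := cos (2 * theta n j).
have kE : k = 1 - 2 * sin (theta n j) ^+ 2.
  rewrite /k mulr_natl cos_mulr2n cos2sin2; ring.
have chE : cosh r ^+ 2 = 1 + sinh r ^+ 2.
  rewrite /cosh /sinh !exprMn !sqrrD sqrrN mulrN e1; by field.
have c2 : expR r + expR (- r) = 2 * cosh r by rewrite /cosh; field.
rewrite bcE /torus_a /torus_d -/k.
suff : (- expR (- r) * cosh r + k) * (expR r * cosh r - k)
   + 4 * sin (theta n j) ^+ 2 * (sin (theta n j) ^+ 2 + sinh r ^+ 2)
   = sinh r ^+ 2.
  move=> h; rewrite -[RHS](divff (expf_neq0 2 s0)) -[X in _ = X / _]h; field.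
  by [].
transitivity (- (expR r * expR (- r)) * cosh r ^+ 2
   + (expR r + expR (- r)) * cosh r * k - k ^+ 2
   + 4 * sin (theta n j) ^+ 2 * (sin (theta n j) ^+ 2 + sinh r ^+ 2)).
  by ring.
rewrite e1 c2.
transitivity (cosh r ^+ 2 * (2 * k - 1) - k ^+ 2
   + 4 * sin (theta n j) ^+ 2 * (sin (theta n j) ^+ 2 + sinh r ^+ 2)).
  by ring.
by rewrite chE kE; ring.
Qed.

Definition torus_x1 : SL 2 R := SL2 torus_a b c torus_d torus_det.

Fact torus_period :
  braid_seq (Dmx r) torus_x1 n = Dmx r /\
  braid_seq (Dmx r) torus_x1 n.+1 = torus_x1.
Proof.
have nE : n = n./2.*2.+1 by rewrite -[LHS]odd_double_half n_odd.
have s0 : sinh r != 0 by rewrite gt_eqF ?sinh_gt0.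
have n0 : n%:R != 0 :> R by rewrite pnatr_eq0 -lt0n (leq_trans _ n3).
have tn : 2 * theta n j *+ n = pi * j%:R.
  by rewrite -mulr_natr /theta; field; rewrite n0.
have [sj cj] := trig_pi_odd j_odd.
have [] := @braid_closing (Dmx r) torus_x1 (2 * theta n j) n./2.
- rewrite /= !tr_mx2 /torus_a /torus_d /cosh; apply: (mulIf s0).
  rewrite [RHS]mulrDl !divfK // /sinh; by field.
- rewrite -[SLval _]/(_ *m _) /= mulmx2 tr_mx2 /torus_a /torus_d.
  rewrite !mul0r addr0 add0r; set k := cos _; apply: (mulIf s0).
  rewrite mulrDl -!mulrA !mulVf // !mulr1.
  transitivity ((expR r - expR (- r)) * k); first by ring.
  by rewrite /sinh; field.
- apply/lt0r_neq0/sin_gt0_pi.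
  have j0 : (0 < j)%N by case: (j) j_odd.
  have jn : (j < n)%N.
    by rewrite (leq_ltn_trans j_le) // ltn_subrL (leq_trans _ n3).
  have tE : 2 * theta n j = pi * (j%:R / n%:R).
    by rewrite /theta; field; rewrite n0.
  have np : 0 < n%:R :> R by rewrite ltr0n (leq_trans _ n3).
  rewrite tE mulr_gt0 ?pi_gt0 ?pi_gt0 ?divr_gt0 ?ltr0n //= ?j0 ?(leq_trans _ n3) //.
  rewrite gtr_pMr ?pi_gt0 // ltr_pdivrMr // mul1r ltr_nat; exact: jn.
- by rewrite -nE tn.
- by rewrite -nE tn.
have [h0 h1] := braid_seqE (Dmx r) torus_x1 n./2.
have [h2 _] := braid_seqE (Dmx r) torus_x1 n./2.+1.
by move=> e0 e1; move: h1 h2; rewrite doubleS -nE => -> ->.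
Qed.

Fact torus_S21 (i : 'Z_n) : S21 r (braid_seq (Dmx r) torus_x1 i).
Proof.
have D0 : S21 r (Dmx r) by exact: (C0_S21 r 0).
have conj x g : S21 r x -> S21 r (x ^ g)%g.
  by move=> [h ->]; exists (h * g)%g; rewrite conjgE invgM !mulgA.
have x10 : S21 r torus_x1.
  have [_ <-] := torus_period.
  have nE : n = n./2.*2.+1 by rewrite -[LHS]odd_double_half n_odd.
  rewrite nE -doubleS; have [-> _] := braid_seqE (Dmx r) torus_x1 n./2.+1.
  exact: conj.
rewrite -(odd_double_half i); have [h0 h1] := braid_seqE (Dmx r) torus_x1 i./2.
by case: odd; rewrite ?add1n ?add0n ?h0 ?h1; exact: conj.
Qed.

Fact torus_crossing (i : 'Z_n) :
  braid_seq (Dmx r) torus_x1 (out_arc i) =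
  ((braid_seq (Dmx r) torus_x1 (over_arc i))^-1 * braid_seq (Dmx r) torus_x1 i
     * braid_seq (Dmx r) torus_x1 (over_arc i))%g.
Proof.
have [p0 p1] := torus_period.
exact: braid_seq_crossing p0 p1 _ (ltn_trans _ n3).
Qed.

(* The arc alpha_i is coloured by the i-th term of the braid sequence started at
   the colours of alpha_0 and alpha_1. *)
Definition Cjbc : coloring n r := Coloring torus_S21 torus_crossing.

Lemma Cjbc_alpha0 : Cjbc 0 = Dmx r. Proof. by []. Qed.
Lemma Cjbc_alpha1 : Cjbc 1 = torus_x1. Proof. by []. Qed.
End TorusColoring.

Fact torus_longitude_det (n : nat) (r : R) :
  - expR (- (2 * n%:R * r)) * - expR (2 * n%:R * r) - 0 * 0 = 1.
Proof. by rewrite mulrNN mulrC expRxMexpNx_1 mulr0 subr0. Qed.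

Definition torus_longitude (n : nat) (r : R) : SL 2 R :=
  SL2 (- expR (- (2 * n%:R * r))) 0 0 (- expR (2 * n%:R * r))
    (torus_longitude_det n r).
End Colorings.

(* Main.v *)
Require Import Defs.
From mathcomp Require Import all_boot all_order all_algebra.
From mathcomp Require Import ring.
From mathcomp Require Import reals sequences exp trigo.
Set Implicit Arguments.
Unset Strict Implicit.
Unset Printing Implicit Defensive.
Import Order.TTheory GRing.Theory Num.Theory.
Local Open Scope ring_scope.

(* Let x and y be the colours of alpha_0 and alpha_1, and P = xy.  The over-arcs
   met along the knot are coloured by y^(P^k), k < n, whose product telescopes to
   (y P^-1)^n P^n = x^-n P^n; so the longitude goes to x^-n P^n x^-n.  For the
   constant colouring P = x^2 and this is 1.  For C_{j,b,c} the trace of P is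
   2 cos (2 theta_j), so P^n = -1 by Cayley-Hamilton, which leaves
   - D(r)^(-2n). *)

Lemma multiplicative1 (G H : groupType) (f : {multiplicative G -> H}) :
  f 1%g = 1%g.
Proof. by apply: (mulgI (f 1%g)); rewrite -gmulfM !mulg1. Qed.

Lemma multiplicativeXVn (G H : groupType) (f : {multiplicative G -> H}) x k :
  f (x ^- k)%g = (f x ^- k)%g.
Proof.
have fX : f (x ^+ k)%g = (f x ^+ k)%g.
  by elim: k => [|k ih]; rewrite ?expg0 ?multiplicative1 // !expgS gmulfM ih.
by apply: (mulgI (f (x ^+ k)%g)); rewrite -gmulfM mulgV multiplicative1 fX mulgV.
Qed.

Lemma multiplicative_longitude n (G : groupType)
    (f : {multiplicative knot_group n -> G}) :
  f (longitude n) =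
    ((\prod_(k < n) f (alpha (over_arc (iter k (@out_arc n) 0%R))))
       * f (meridian n) ^- n)%g.
Proof.
by rewrite gmulfM multiplicativeXVn (big_morph f gmulfM (multiplicative1 f)).
Qed.

Lemma Psi_longitude (R : realType) n (r : R) (C : coloring n r) :
  Psi C (longitude n) =
    ((\prod_(k < n) C (over_arc (iter k (@out_arc n) 0%R))) * C 0 ^- n)%g.
Proof.
rewrite multiplicative_longitude /meridian Psi_alpha; congr (_ * _)%g.
by apply: eq_bigr => k _; rewrite Psi_alpha.
Qed.

(** Conjugation by a fixed element passes through products and powers, so only the colorings without
    [rho] remain to be computed. *)
Lemma Psi_inner_longitude (R : realType) n (r : R)
    (rho : inner_automorphism (SL 2 R)) (C : coloring n r) :
  Psi (inner_coloring rho C) (longitude n) = rho (Psi C (longitude n)).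
Proof.
have [g rhoE] := innerP rho; have rhoJ y : rho y = (y ^ g)%g.
  by rewrite rhoE conjgE mulgA.
rewrite !Psi_longitude rhoJ conjMg conjVg conjXg conjg_prod /= rhoJ.
by congr (_ * _)%g; apply: eq_bigr => k _; rewrite rhoJ.
Qed.

(** Each under-crossing advances the arc index by 2, and the over-arc lies one further. The bound on
    [n] makes ['Z_n] the integers mod [n]. *)
Lemma over_arc_iter n k : (1 < n)%N ->
  over_arc (iter k (@out_arc n) 0%R) = (k.*2.+1 %% n)%N :> nat.
Proof.
move=> n1; rewrite /over_arc.
have -> : iter k (@out_arc n) 0%R = (k.*2)%:R.
  elim: k => [|k ih] //.
  by rewrite iterS ih /out_arc -natrD addn2.
by rewrite -[1]/(1%:R) -natrD val_Zp_nat // addn1.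
Qed.

Lemma prodg_conj_powers (G : groupType) (x y : G) n :
  (\prod_(k < n) y ^ (x * y) ^+ k)%g = (x ^- n * (x * y) ^+ n)%g.
Proof.
elim: n => [|n ih]; first by rewrite big_ord0 !expg0 invg1 mulg1.
rewrite big_ord_recr /= ih conjgE !mulgA mulgK -!mulgA.
(* With P = xy, the goal is now x^-n y P^n = x^-(n+1) P^(n+1), which holds since y = x^-1 P. *)
by rewrite (expgS x n) (expgS (x * y)%g n) invgM -!mulgA mulKg.
Qed.

(** In the Cayley-Hamilton formula [SL2_expg] the coefficient of A vanishes, and sin(nt) =
    sin((n+1)t - t) = sin t, which can be divided out. *)
Lemma SL2_expg_opp1 (R : realType) (A : SL 2 R) (t : R) n :
  \tr A = 2 * cos t -> sin t != 0 ->
  sin (t *+ n.+1) = 0 -> cos (t *+ n.+1) = -1 ->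
  (A ^+ n.+1)%g = - 1%:M :> 'M_2.
Proof.
move=> trA st0 sn cn; apply: (scalerI st0).
rewrite SL2_expg // sn scale0r add0r scalerN; congr (- (_ *: _)).
have -> : t *+ n = t *+ n.+1 - t by rewrite mulrSr addrK.
by rewrite sinB sn cn; ring.
Qed.

Lemma Dmx_expg (R : realType) (r : R) n :
  (Dmx r ^+ n)%g = mx2 (expR (n%:R * r)) 0 0 (expR (- (n%:R * r))) :> 'M_2.
Proof.
rewrite -mulrN !expRM_natl; elim: n => [|n ih].
  by rewrite expg0 !expr0 -scalar_mx2.
rewrite expgS -[LHS]/(SLval (Dmx r) *m SLval (Dmx r ^+ n)%g) ih mulmx2.
by rewrite !mul0r !mulr0 !addr0 add0r -!exprS.
Qed.

Section TorusLongitude.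
Variables (R : realType) (n j : nat) (r b c : R).
Hypotheses (n3 : (3 <= n)%N) (n_odd : odd n) (r0 : 0 < r).
Hypotheses (j_odd : odd j) (j_le : (j <= n - 2)%N).
Hypothesis bcE : b * c =
  - (4 * sin (theta R n j) ^+ 2 * (sin (theta R n j) ^+ 2 + sinh r ^+ 2))
    / sinh r ^+ 2.

Let x1 : SL 2 R := torus_x1 r0 bcE.

(** The trace is e^r a + e^-r d: the cosh terms cancel, and e^r - e^-r = 2 sinh r cancels the
    denominator. *)
Lemma torus_product_tr : \tr (Dmx r * x1)%g = 2 * cos (2 * theta R n j).
Proof.
have s0 : sinh r != 0 by rewrite gt_eqF ?sinh_gt0.
rewrite -[SLval _]/(_ *m _) /= mulmx2 tr_mx2 /torus_a /torus_d.
rewrite !mul0r addr0 add0r; move: s0; rewrite /sinh => s0; field.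
by apply: contraNneq s0 => ->; rewrite mul0r.
Qed.

Lemma torus_product_expg : ((Dmx r * x1) ^+ n)%g = - 1%:M :> 'M_2.
Proof.
have n_gt0 : (0 < n)%N by rewrite (leq_trans _ n3).
have n0 : n%:R != 0 :> R by rewrite pnatr_eq0 -lt0n.
have tE : 2 * theta R n j = pi * (j%:R / n%:R).
  by rewrite /theta; field.
have tn : 2 * theta R n j *+ n = pi * j%:R.
  by rewrite tE -mulr_natr -mulrA divfK.
have [sj cj] := trig_pi_odd R j_odd.
have nE : n = n.-1.+1 by rewrite prednK.
rewrite nE; apply: (SL2_expg_opp1 torus_product_tr); rewrite -?nE ?tn //.
(* Since 0 < j < n, the angle pi j/n lies strictly between 0 and pi, so its sine is nonzero. *)
apply/lt0r_neq0/sin_gt0_pi; rewrite tE.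
have j_gt0 : (0 < j)%N by case: (j) j_odd.
have jn : (j < n)%N by rewrite (leq_ltn_trans j_le) // ltn_subrL.
rewrite mulr_gt0 ?pi_gt0 ?divr_gt0 ?ltr0n //=.
by rewrite gtr_pMr ?pi_gt0 // ltr_pdivrMr ?ltr0n // mul1r ltr_nat.
Qed.

(** The over-arc index is 2k+1 mod n; periodicity of the braid sequence removes the reduction, and
    odd terms are conjugates of [x1]. *)
Lemma torus_over_color k :
  Cjbc n3 n_odd r0 j_odd j_le bcE (over_arc (iter k (@out_arc n) 0%R)) =
    (x1 ^ (Dmx r * x1) ^+ k)%g.
Proof.
have [p0 p1] := torus_period n3 n_odd r0 j_odd j_le bcE.
rewrite -[LHS]/(braid_seq (Dmx r) x1 (over_arc (iter k (@out_arc n) 0))).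
rewrite over_arc_iter ?(ltn_trans _ n3) // (braid_seq_mod p0 p1).
by have [_ ->] := braid_seqE (Dmx r) x1 k.
Qed.

Lemma Cjbc_longitude :
  Psi (Cjbc n3 n_odd r0 j_odd j_le bcE) (longitude n) = torus_longitude n r.
Proof.
rewrite Psi_longitude (eq_bigr _ (fun (k : 'I_n) _ => torus_over_color k)).
rewrite prodg_conj_powers Cjbc_alpha0.
(* Multiplying by D^n on both sides clears the inverses: with L the claimed longitude, it remains to
   check P^n = D^n L D^n on explicit matrices. *)
apply: (mulIg (Dmx r ^+ n)%g); rewrite mulgVK.
apply: (mulgI (Dmx r ^+ n)%g); rewrite mulVKg; apply: val_inj.
rewrite /= torus_product_expg.
rewrite -[RHS]/(SLval (Dmx r ^+ n)%g *m (SLval (torus_longitude n r)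
  *m SLval (Dmx r ^+ n)%g)) Dmx_expg /= !mulmx2 scalar_mx2.
have e2 : 2 * n%:R * r = n%:R * r + n%:R * r by ring.
have e1 : expR (n%:R * r) * expR (- (n%:R * r)) = 1 by exact: expRxMexpNx_1.
(* Here p = e^(nr), q = e^(-nr) and L = diag(-q^2, -p^2), so pq = 1 gives -1 on the diagonal. *)
rewrite e2 opprD !expRD; move: e1; set p := expR _; set q := expR _ => e1.
have d1 : p * (- (q * q) * p) = -1.
  by transitivity (- ((p * q) * (p * q))); [ring | rewrite e1 mulr1].
have d2 : q * (- (p * p) * q) = -1.
  by transitivity (- ((p * q) * (p * q))); [ring | rewrite e1 mulr1].
rewrite !(mul0r, mulr0, addr0, add0r) d1 d2.
by apply/matrixP => i k; rewrite !mxE; case: (i == 0); case: (k == 0);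
  rewrite ?oppr0.
Qed.

End TorusLongitude.

Lemma C0_longitude (R : realType) n (r : R) : Psi (C0 n r) (longitude n) = 1%g.
Proof. by rewrite Psi_longitude /= prodg_const card_ord mulgV. Qed.

Theorem theorem8p3 (R : realType) (n : nat) (n3 : (3 <= n)%N) (n_odd : odd n)
    (r : R) (r0 : 0 < r) (rho : inner_automorphism (SL 2 R)) :
  longitudinal_map (x := rho (Dmx r))
    (exist _ (Psi (inner_coloring rho (C0 n r)))
             (Psi_inner_meridian rho (C0_alpha0 n r)))
    = 1%g
  /\
  forall (j : nat) (j_odd : odd j) (j_le : (j <= n - 2)%N) (b c : R)
    (bcE : b * c =
       - (4 * sin (theta R n j) ^+ 2
            * (sin (theta R n j) ^+ 2 + sinh r ^+ 2))
         / sinh r ^+ 2),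
  longitudinal_map (x := rho (Dmx r))
    (exist _ (Psi (inner_coloring rho (Cjbc n3 n_odd r0 j_odd j_le bcE)))
             (Psi_inner_meridian rho
                (Cjbc_alpha0 n3 n_odd r0 j_odd j_le bcE)))
    = rho (torus_longitude n r).
Proof.
split=> [|j j_odd j_le b c bcE]; apply: (etrans (Psi_inner_longitude _ _)).
  by rewrite C0_longitude; have [g ->] := innerP rho; rewrite mulg1 mulVg.
by rewrite Cjbc_longitude.
Qed.
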